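(* Let $a,b\in\mathbb N$ and let $S(a_{\mathbf t})$ be the $(a+1)\times(a+1)$ matrix weight defined in the context. For all $\mathbf t=(t_1,t_2)\in\mathbb R^2$ $$\det\bigl(S(a_{\mathbf t})\bigr)=\Bigl(\prod_{n=0}^a\binom an\Bigr)^{-2}\bigl(\cos t_1\cos t_2\bigr)^{2b(a+1)}\bigl(\cos t_1\cos t_2(\cos^2t_1-\cos^2t_2)\bigr)^{a(a+1)}.$$
   Context: $\mathbb N=\{0,1,2,\dots\}$. For $a,b\in\mathbb N$, $0\le i,k\le a$ and $\mathbf t=(t_1,t_2)\in\mathbb R^2$ put $$q_{i,k}(\mathbf t)=(\cos t_1)^{a+b-k}\sum_{p=0}^{\min(i,k)}\frac{(-i)_p(-k)_p}{p!\,(-a)_p}(\cos^2t_2-\cos^2t_1)^p(\cos t_2)^{b+2i+k-2p},\qquad (x)_p=\prod_{l=0}^{p-1}(x+l),$$ which equals $(\cos t_1)^{a+b-k}(\cos t_2)^{b+2i+k}K_i\bigl(k;\tfrac{\cos^2t_2}{\cos^2t_2-\cos^2t_1},a\bigr)$ with $K_i$ a Krawtchouk polynomial. The matrix weight is $S(a_{\mathbf t})=Q_0(a_{\mathbf t})Q_0(a_{\mathbf t})^\ast$ with $(Q_0(a_{\mathbf t}))_{i,k}=q_{i,k}(\mathbf t)$, i.e. $S(a_{\mathbf t})_{i,j}=\sum_{k=0}^aq_{i,k}(\mathbf t)\,q_{j,k}(\mathbf t)$, $0\le i,j\le a$. *)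

(* Defs.v *)
From mathcomp Require Import all_boot all_order all_algebra.
From mathcomp Require Import all_classical all_reals all_analysis.

Set Implicit Arguments.
Unset Strict Implicit.
Unset Printing Implicit Defensive.

Import Order.TTheory GRing.Theory Num.Theory.
Local Open Scope ring_scope.

Definition pochhammer (F : comNzRingType) (x : F) (p : nat) : F :=
  \prod_(l < p) (x + l%:R).

(* The exponents [a + b - k] and [b + 2 * i + k - 2 * p] are natural-number
   subtractions; they never truncate, since [k <= a] and [p <= minn i k], and
   for the same reason [pochhammer (- a%:R) p] is nonzero. *)
Definition qfun (R : realType) (a b i k : nat) (t : R * R) : R :=
  cos t.1 ^+ (a + b - k) *
  \sum_(p < (minn i k).+1)
    pochhammer (- i%:R) p * pochhammer (- k%:R) p /
      (p`!%:R * pochhammer (- a%:R) p) *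
    (cos t.2 ^+ 2 - cos t.1 ^+ 2) ^+ p *
    cos t.2 ^+ (b + 2 * i + k - 2 * p).

Definition Q0 (R : realType) (a b : nat) (t : R * R) : 'M[R]_a.+1 :=
  \matrix_(i < a.+1, k < a.+1) qfun a b i k t.

(* [Q0] has real entries, so its adjoint is its transpose. *)
Definition weight (R : realType) (a b : nat) (t : R * R) : 'M[R]_a.+1 :=
  Q0 a b t *m (Q0 a b t)^T.

Lemma weightE (R : realType) (a b : nat) (t : R * R) (i j : 'I_a.+1) :
  weight a b t i j = \sum_(k < a.+1) qfun a b i k t * qfun a b j k t.
Proof. by rewrite mxE; apply: eq_bigr => k _; rewrite !mxE. Qed.

(* Main.v *)
Require Import Defs.
From mathcomp Require Import all_boot all_order all_algebra.
From mathcomp Require Import all_classical all_reals all_analysis.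
From mathcomp Require Import ring zify.

(* With (-n)_p = (-1)^p n!/(n-p)!, the p-th coefficient of q_{i,k} is
   (-1)^p C(i,p) C(k,p) / C(a,p), and its power of cos t_2 splits as
   (cos t_2)^(2(i-p)) (cos t_2)^(b+k). Hence Q_0 = L W^T with L and W lower
   triangular and L unipotent, and det S = (det Q_0)^2 is the square of the
   product of the diagonal entries of W. *)

Set Implicit Arguments.
Unset Strict Implicit.
Unset Printing Implicit Defensive.

Import Order.TTheory GRing.Theory Num.Theory.
Local Open Scope ring_scope.

Lemma pochhammerN_nat (F : comNzRingType) (n p : nat) :
  pochhammer (- n%:R : F) p = (-1) ^+ p * (n ^_ p)%:R.
Proof.
elim: p => [|p IHp]; first by rewrite /pochhammer big_ord0 ffactn0 mulr1.
have -> : pochhammer (- n%:R : F) p.+1 =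
          pochhammer (- n%:R) p * (- n%:R + p%:R).
  by rewrite /pochhammer big_ord_recr.
rewrite IHp ffactnSr exprS natrM.
(* The truncated [n - p] agrees with the true difference only for [p <= n]; beyond that [n ^_ p] is
   zero and both sides vanish. *)
have [le_pn|lt_np] := leqP p n; first by rewrite natrB //; ring.
by rewrite ffact_small // !(mulr0, mul0r).
Qed.

(** Each falling factorial is a binomial times [p!]: both factorials cancel, and of the three signs
    one survives. *)
Lemma pochhammer_ratio (F : numFieldType) (a i k p : nat) :
  (p <= a)%N ->
  pochhammer (- i%:R : F) p * pochhammer (- k%:R) p /
    (p`!%:R * pochhammer (- a%:R) p) =
  (-1) ^+ p * 'C(i, p)%:R * 'C(k, p)%:R / 'C(a, p)%:R.
Proof.
move=> le_pa; rewrite !pochhammerN_nat -!bin_ffact !natrM.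
have f0 : p`!%:R != 0 :> F by rewrite pnatr_eq0 -lt0n fact_gt0.
have b0 : 'C(a, p)%:R != 0 :> F by rewrite pnatr_eq0 -lt0n bin_gt0.
have s0 : (-1) ^+ p != 0 :> F by rewrite signr_eq0.
by field; rewrite f0 b0 s0.
Qed.

Definition lower_factor (R : realType) (a : nat) (t : R * R) : 'M[R]_a.+1 :=
  \matrix_(i, p) ('C(i, p)%:R * cos t.2 ^+ (2 * (i - p))).

(** Stored transposed, so that [det_trig] applies to both factors. The sign $(-1)^p$ is absorbed by
    reversing the difference of squared cosines. *)
Definition upper_factor_tr (R : realType) (a b : nat) (t : R * R) :
    'M[R]_a.+1 :=
  \matrix_(k, p) (cos t.1 ^+ (a + b - k) * cos t.2 ^+ (b + k) *
    'C(k, p)%:R / 'C(a, p)%:R * (cos t.1 ^+ 2 - cos t.2 ^+ 2) ^+ p).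

Lemma Q0_factorization (R : realType) (a b : nat) (t : R * R) :
  Q0 a b t = lower_factor a t *m (upper_factor_tr a b t)^T.
Proof.
apply/matrixP => i k; rewrite !mxE /qfun mulr_sumr.
have le_ik : ((minn i k).+1 <= a.+1)%N by rewrite ltnS geq_min -ltnS ltn_ord.
(* The matrix product sums over all [p <= a]; the terms with [p > minn i k] contribute nothing, as
   ['C(i, p)] or ['C(k, p)] is zero. *)
rewrite (big_ord_widen _ (fun p : nat => cos t.1 ^+ (a + b - k) *
  (pochhammer (- i%:R) p * pochhammer (- k%:R) p /
      (p`!%:R * pochhammer (- a%:R) p) *
    (cos t.2 ^+ 2 - cos t.1 ^+ 2) ^+ p *
    cos t.2 ^+ (b + 2 * i + k - 2 * p))) le_ik) big_mkcond /=.
apply: eq_bigr => p _; rewrite !mxE ltnS leq_min.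
have [le_pi|lt_ip] := leqP p i; last by rewrite bin_small // !mul0r.
have [le_pk|lt_kp] := leqP p k; last first.
  by rewrite (bin_small lt_kp) !(mulr0, mul0r).
rewrite pochhammer_ratio -1?ltnS //=.
have -> : (b + 2 * i + k - 2 * p = 2 * (i - p) + (b + k))%N by lia.
rewrite -[cos t.1 ^+ 2 - _]opprB (exprNn (_ - _)) (exprD _ (2 * (i - p))); ring.
Qed.

Lemma det_lower_factor (R : realType) (a : nat) (t : R * R) :
  \det (lower_factor a t) = 1.
Proof.
rewrite det_trig; last first.
  by apply/is_trig_mxP => i j lt_ij; rewrite mxE bin_small ?mul0r.
by rewrite big1 // => i _; rewrite mxE binn subnn muln0 mulr1.
Qed.

(** Along the diagonal the exponents are $b+(a-k)$, $b+k$ and $k$; both $k$ and $a-k$ add up to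
    $\binom{a+1}{2}$, which makes the result symmetric in the two cosines up to the difference
    factor. *)
Lemma det_upper_factor_tr (R : realType) (a b : nat) (t : R * R) :
  \det (upper_factor_tr a b t) =
    (\prod_(k < a.+1) 'C(a, k)%:R)^-1 *
    (cos t.1 * cos t.2) ^+ (b * (a + 1)) *
    (cos t.1 * cos t.2 * (cos t.1 ^+ 2 - cos t.2 ^+ 2)) ^+ 'C(a.+1, 2).
Proof.
rewrite det_trig; last first.
  apply/is_trig_mxP => i j lt_ij.
  by rewrite mxE (bin_small lt_ij) !(mulr0, mul0r).
have sum_id : (\sum_(k < a.+1) k = 'C(a.+1, 2))%N.
  by rewrite -bin2_sum big_mkord.
have sum_rev : (\sum_(k < a.+1) (a - k) = 'C(a.+1, 2))%N.
  rewrite -sum_id (reindex_inj rev_ord_inj) /=.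
  by apply: eq_bigr => k _; rewrite subSS subKn // -ltnS.
under eq_bigr => k _.
  rewrite mxE binn mulr1 -addnBAC -1?ltnS //.
  rewrite !(exprD, mulrA); over.
rewrite !big_split /= !prodrXr sum_id sum_rev prodfV.
rewrite sum_nat_const card_ord mulnC addn1 !exprMn; ring.
Qed.

Theorem proposition5p3 (R : realType) (a b : nat) (t : R * R) :
  \det (weight a b t) =
    (\prod_(n < a.+1) 'C(a, n)%:R) ^- 2 *
    (cos t.1 * cos t.2) ^+ (2 * b * (a + 1)) *
    (cos t.1 * cos t.2 * (cos t.1 ^+ 2 - cos t.2 ^+ 2)) ^+ (a * (a + 1)).
Proof.
rewrite /weight det_mulmx det_tr Q0_factorization det_mulmx det_tr.
rewrite det_lower_factor mul1r det_upper_factor_tr -expr2 !exprMn exprVn.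
(* Halving in [bin2] is exact since one of two consecutive integers is even. *)
have -> : (a * (a + 1) = 'C(a.+1, 2) * 2)%N.
  by rewrite bin2 muln2 halfK oddM /= andNb subn0 mulnC addn1.
have -> : (2 * b * (a + 1) = b * (a + 1) * 2)%N by lia.
by rewrite !exprM.
Qed.
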